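(* Let $(M,\tilde\varphi,\xi,\eta,\tilde g)$ be a paracontact $(\tilde\kappa,\tilde\mu)$-manifold with $\tilde\kappa\neq-1$. Then $(\tilde\varphi,\xi,\eta)$ is integrable, i.e. $N_{\tilde\varphi}(X,Y)$ is a section of $\mathbb R\xi$ for all sections $X,Y$ of $\mathcal D=\ker\eta$.
   Context: Conventions: $2d\eta(X,Y)=X(\eta(Y))-Y(\eta(X))-\eta([X,Y])$; $R_{XY}Z=\nabla_X\nabla_YZ-\nabla_Y\nabla_XZ-\nabla_{[X,Y]}Z$. An almost paracontact structure on a $(2n+1)$-dimensional manifold $M$ is $(\tilde\varphi,\xi,\eta)$, with $\tilde\varphi$ a $(1,1)$-tensor field, $\xi$ a vector field, $\eta$ a 1-form, such that $\eta(\xi)=1$, $\tilde\varphi^2=I-\eta\otimes\xi$ and the $\pm1$-eigendistributions of $\tilde\varphi$ on $\mathcal D=\ker\eta$ both have dimension $n$. With a pseudo-Riemannian metric $\tilde g$ satisfying $\tilde g(\tilde\varphi X,\tilde\varphi Y)=-\tilde g(X,Y)+\eta(X)\eta(Y)$ and $d\eta(X,Y)=\tilde g(X,\tilde\varphi Y)$ it is a paracontact metric structure. Put $\tilde h=\frac12\mathcal L_\xi\tilde\varphi$. A paracontact $(\tilde\kappa,\tilde\mu)$-manifold ($\tilde\kappa,\tilde\mu$ real constants) is a paracontact metric manifold whose curvature tensor satisfies $\tilde R_{XY}\xi=\tilde\kappa(\eta(Y)X-\eta(X)Y)+\tilde\mu(\eta(Y)\tilde hX-\eta(X)\tilde hY)$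 for all vector fields $X,Y$. $N_{\tilde\varphi}:=[\tilde\varphi,\tilde\varphi]-2d\eta\otimes\xi$, where $[\tilde\varphi,\tilde\varphi](X,Y)=\tilde\varphi^2[X,Y]+[\tilde\varphi X,\tilde\varphi Y]-\tilde\varphi[\tilde\varphi X,Y]-\tilde\varphi[X,\tilde\varphi Y]$. *)

(* Defs.v *)
From HB Require Import structures.
From mathcomp Require Import all_boot all_order all_algebra.
From mathcomp Require Import mathcomp_extra boolp classical_sets functions.
From mathcomp Require Import reals topology normedtype derive.
From mathcomp Require Import ring.

Set Implicit Arguments.
Unset Strict Implicit.
Unset Printing Implicit Defensive.

Import Order.TTheory GRing.Theory Num.Theory.
Import numFieldNormedType.Exports.

Local Open Scope classical_set_scope.
Local Open Scope ring_scope.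

(* [Ck U k f]: all iterated partial derivatives of [f] of order at most [k]
   exist and are continuous at the points of [U].  [U] is meant to be open; the
   values of [f] outside [U] are then irrelevant. *)
Fixpoint Ck (R : realType) (m : nat) (W : normedModType R)
    (U : set 'rV[R]_m) (k : nat) (f : 'rV[R]_m -> W) : Prop :=
  (forall x, U x -> {for x, continuous f}) /\
  match k with
  | 0 => True
  | k'.+1 => forall i : 'I_m,
      (forall x, U x -> derivable f x (delta_mx ord0 i)) /\
      Ck U k' ('D_(delta_mx ord0 i) f)
  end.

Definition smooth_on (R : realType) (m : nat) (W : normedModType R)
    (U : set 'rV[R]_m) (f : 'rV[R]_m -> W) : Prop :=
  forall k, Ck U k f.

Section CkTheory.
Variables (R : realType) (m : nat) (U : set 'rV[R]_m).
Hypothesis oU : open U.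

Lemma Ck_ext (W : normedModType R) k (f g : 'rV[R]_m -> W) :
  (forall x, U x -> f x = g x) -> Ck U k f -> Ck U k g.
Proof.
elim: k f g => [|k IH] f g fg [cf df].
all: have near_fg x : U x -> \near x, f x = g x by
  move=> Ux; near=> y; apply: fg; near: y; exact: open_nbhs_nbhs.
all: have cg x : U x -> {for x, continuous g} by
  move=> Ux; rewrite /prop_for /continuous_at -(fg _ Ux);
  exact: cvg_trans (near_eq_cvg (near_fg x Ux)) (cf x Ux).
  by split.
split=> // i; have [dfi Cfi] := df i.
split.
  by move=> x Ux; apply: near_eq_derivable (near_fg x Ux) _; exact: dfi.
apply: IH Cfi => x Ux.
exact: near_eq_derive (near_fg x Ux).
Unshelve. all: by end_near. Qed.

Lemma CkS (W : normedModType R) k (f : 'rV[R]_m -> W) :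
  Ck U k.+1 f -> Ck U k f.
Proof.
elim: k f => [|k IH] f; first by case.
case=> cf df; split=> // i; have [dfi Cfi] := df i.
by split=> //; apply: IH.
Qed.

Lemma Ck_cst (W : normedModType R) k (a : W) : Ck U k (cst a).
Proof.
have cc b x : U x -> {for x, continuous (@cst 'rV[R]_m W b)} by
  move=> _; exact: cst_continuous.
elim: k a => [|k IH] a; split; try exact: cc; first by [].
move=> i; split; first by move=> x _; exact: derivable_cst.
by apply: Ck_ext (IH 0) => x _; rewrite derive_cst.
Qed.

Lemma CkD (W : normedModType R) k (f g : 'rV[R]_m -> W) :
  Ck U k f -> Ck U k g -> Ck U k (f \+ g).
Proof.
elim: k f g => [|k IH] f g [cf df] [cg dg].
  by split=> // x Ux; apply: continuousD; [exact: cf|exact: cg].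
split=> [x Ux|i]; first by apply: continuousD; [exact: cf|exact: cg].
have [dfi Cfi] := df i; have [dgi Cgi] := dg i.
split; first by move=> x Ux; apply: derivableD; [exact: dfi|exact: dgi].
apply: Ck_ext (IH _ _ Cfi Cgi) => x Ux /=.
by rewrite deriveD; [|exact: dfi|exact: dgi].
Qed.

Lemma CkM k (f g : 'rV[R]_m -> R) :
  Ck U k f -> Ck U k g -> Ck U k (f \* g).
Proof.
elim: k f g => [|k IH] f g Cf Cg; have [cf df] := Cf; have [cg dg] := Cg.
  by split=> // x Ux; apply: continuousM; [exact: cf|exact: cg].
split=> [x Ux|i]; first by apply: continuousM; [exact: cf|exact: cg].
have [dfi Cfi] := df i; have [dgi Cgi] := dg i.
split; first by move=> x Ux; apply: derivableM; [exact: dfi|exact: dgi].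
apply: Ck_ext (CkD (IH _ _ (CkS Cf) Cgi) (IH _ _ (CkS Cg) Cfi)) => x Ux /=.
by rewrite deriveM; [|exact: dfi|exact: dgi].
Qed.

End CkTheory.

(* A chart is a homeomorphism [chart_fun], with inverse [chart_inv], from the
   open set [chart_dom] onto an open set of R^m; both maps are total functions
   whose values elsewhere are irrelevant. *)
Record chart (R : realType) (m : nat) (M : topologicalType) := Chart {
  chart_dom : set M;
  chart_fun : M -> 'rV[R]_m;
  chart_inv : 'rV[R]_m -> M;
  chart_dom_open : open chart_dom;
  chart_img_open : open (chart_fun @` chart_dom);
  chart_funK : forall p, chart_dom p -> chart_inv (chart_fun p) = p;
  chart_fun_continuous : forall p, chart_dom p -> {for p, continuous chart_fun};
  chart_inv_continuous : forall x, (chart_fun @` chart_dom) x ->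
    {for x, continuous chart_inv}
}.

Record manifold (R : realType) (m : nat) := Manifold {
  points :> topologicalType;
  points_hausdorff : hausdorff_space points;
  points_second_countable : @second_countable points;
  atlas : set (chart R m points);
  atlas_cover : forall p : points, exists2 c, atlas c & chart_dom c p;
  atlas_compatible : forall c c', atlas c -> atlas c' ->
    smooth_on (chart_fun c @` (chart_dom c `&` chart_dom c'))
              (chart_fun c' \o chart_inv c)
}.

Section SmoothFunctions.
Variables (R : realType) (m : nat) (M : manifold R m).

Definition smooth (f : M -> R) : Prop :=
  forall c, atlas c -> smooth_on (chart_fun c @` chart_dom c) (f \o chart_inv c).

Definition smooth_pred : {pred M -> R} := fun f => `[< smooth f >].

Record Cinfty := MkCinfty {
  Cinfty_val :> M -> R;
  Cinfty_valP : Cinfty_val \in smooth_pred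
}.

HB.instance Definition _ := [isSub for Cinfty_val].
HB.instance Definition _ := [Choice of Cinfty by <:].

Lemma smooth_cst (a : R) : smooth (cst a).
Proof. by move=> c _ k; apply: Ck_cst; exact: chart_img_open. Qed.

Lemma smoothD f g : smooth f -> smooth g -> smooth (f + g).
Proof.
by move=> sf sg c Ac k; apply: CkD; [exact: chart_img_open|exact: sf|exact: sg].
Qed.

Lemma smoothM f g : smooth f -> smooth g -> smooth (f * g).
Proof.
by move=> sf sg c Ac k; apply: CkM; [exact: chart_img_open|exact: sf|exact: sg].
Qed.

Lemma smoothZ a (f : M -> R^o) : smooth f -> smooth (a *: f).
Proof. by move=> sf; exact: smoothM (smooth_cst a) sf. Qed.

Lemma smooth_subring_closed : subring_closed smooth_pred.
Proof.
split=> [|f g /asboolP sf /asboolP sg|f g /asboolP sf /asboolP sg];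
  apply/asboolP.
- exact: smooth_cst.
- by rewrite -scaleN1r; apply: smoothD => //; exact: smoothZ.
- exact: smoothM.
Qed.

HB.instance Definition _ :=
  GRing.SubChoice_isSubComPzRing.Build _ _ Cinfty smooth_subring_closed.

Lemma smooth_submod_closed : subsemimod_closed smooth_pred.
Proof.
split; first split.
- exact/asboolP/smooth_cst.
- by move=> f g /asboolP sf /asboolP sg; apply/asboolP/smoothD.
- by move=> a f /asboolP sf; apply/asboolP/smoothZ.
Qed.

HB.instance Definition _ :=
  GRing.SubZmodule_isSubLmodule.Build R (M -> R) _ Cinfty smooth_submod_closed.

Definition Cinfty_cst (a : R) : Cinfty := a *: (1 : Cinfty).

End SmoothFunctions.

(* Vector fields are the derivations of the R-algebra of smooth functions. *)
Section VectorFields.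
Variables (R : realType) (m : nat) (M : manifold R m).

Definition derivation (X : Cinfty M -> Cinfty M) : Prop :=
  linear X /\ forall f g, X (f * g) = X f * g + f * X g.

Definition derivation_pred : {pred Cinfty M -> Cinfty M} :=
  fun X => `[< derivation X >].

Record vfield := MkVfield {
  vfield_val :> Cinfty M -> Cinfty M;
  vfield_valP : vfield_val \in derivation_pred
}.

HB.instance Definition _ := [isSub for vfield_val].
HB.instance Definition _ := [Choice of vfield by <:].

Lemma derivation_zmod_closed : zmod_closed derivation_pred.
Proof.
split=> [|X Y /asboolP[lX dX] /asboolP[lY dY]]; apply/asboolP; split.
- by move=> a f g; rewrite scaler0 addr0.
- by move=> f g; rewrite mul0r mulr0 addr0.
- by move=> a f g; rewrite !fctE lX lY scalerBr opprD addrACA.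
- by move=> f g; rewrite !fctE dX dY mulrBl mulrBr opprD addrACA.
Qed.

HB.instance Definition _ :=
  GRing.SubChoice_isSubZmodule.Build _ _ vfield derivation_zmod_closed.

Lemma vfieldP (X Y : vfield) : (forall f, X f = Y f) -> X = Y.
Proof. by move=> XY; apply/val_inj/funext. Qed.

Lemma Cinfty_scaleAl (a : R) (f g : Cinfty M) : a *: (f * g) = (a *: f) * g.
Proof. by apply/val_inj/funext => p; exact: mulrA. Qed.

Lemma derivation_scale (f : Cinfty M) (X : vfield) :
  derivation (fun g => f * X g).
Proof.
have /asboolP[lX dX] := vfield_valP X.
split=> [a g h|g h].
  by rewrite lX mulrDr [f * (a *: _)]mulrC -Cinfty_scaleAl [X g * f]mulrC.
by rewrite dX mulrDr mulrA [g * (f * _)]mulrCA.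
Qed.

Definition vfield_scale (f : Cinfty M) (X : vfield) : vfield :=
  MkVfield (asboolT (derivation_scale f X)).

Fact vfield_scaleA f g X :
  vfield_scale f (vfield_scale g X) = vfield_scale (f * g) X.
Proof. by apply: vfieldP => h /=; rewrite mulrA. Qed.

Fact vfield_scale1 : left_id 1 vfield_scale.
Proof. by move=> X; apply: vfieldP => h /=; rewrite mul1r. Qed.

Fact vfield_scaleDr : right_distributive vfield_scale +%R.
Proof. by move=> f X Y; apply: vfieldP => h; exact: mulrDr. Qed.

Fact vfield_scaleDl X : {morph vfield_scale^~ X : f g / f + g}.
Proof. by move=> f g; apply: vfieldP => h; exact: mulrDl. Qed.

HB.instance Definition _ := GRing.Zmodule_isLmodule.Build (Cinfty M) vfield
  vfield_scaleA vfield_scale1 vfield_scaleDr vfield_scaleDl.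

Lemma derivation_bracket (X Y : vfield) :
  derivation (fun f => X (Y f) - Y (X f)).
Proof.
have /asboolP[lX dX] := vfield_valP X.
have /asboolP[lY dY] := vfield_valP Y.
have aX f g : X (f + g) = X f + X g by have := lX 1 f g; rewrite !scale1r.
have aY f g : Y (f + g) = Y f + Y g by have := lY 1 f g; rewrite !scale1r.
split=> [a f g|f g].
  by rewrite lY lX lX lY opprD addrACA scalerBr.
by rewrite dX dY aX aY !dX !dY; ring.
Qed.

Definition lie_bracket (X Y : vfield) : vfield :=
  MkVfield (asboolT (derivation_bracket X Y)).

End VectorFields.

Section Tensors.
Variables (R : realType) (m : nat) (M : manifold R m).
Implicit Types (X Y Z : vfield M) (f : Cinfty M) (p : M).

(* The tangent vector of [X] at [p], as an R-linear form on smooth functions. *)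
Definition vect_at p X : Cinfty M -> R := fun f => X f p.

(* Tensor fields are encoded as Cinfty-multilinear maps on vector fields; their
   value at [p] is read off from arbitrary vector fields extending the tangent
   vectors at [p], every tangent vector having such an extension. *)

Definition pseudo_riemannian_metric (g : vfield M -> vfield M -> Cinfty M) : Prop :=
  [/\ forall X, scalar (g X),
      forall X Y, g X Y = g Y X &
      forall p X, (forall Y, g X Y p = 0) -> vect_at p X = 0].

Record affine_connection (nabla : vfield M -> vfield M -> vfield M) : Prop := {
  conn_linear : forall Y, linear (nabla^~ Y);
  conn_add : forall X Y Z, nabla X (Y + Z) = nabla X Y + nabla X Z;
  conn_leibniz : forall X f Y, nabla X (f *: Y) = X f *: Y + f *: nabla X Y
}.

Record levi_civita (g : vfield M -> vfield M -> Cinfty M)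
    (nabla : vfield M -> vfield M -> vfield M) : Prop := {
  lc_connection : affine_connection nabla;
  lc_torsion_free : forall X Y, nabla X Y - nabla Y X = lie_bracket X Y;
  lc_metric : forall X Y Z, X (g Y Z) = g (nabla X Y) Z + g Y (nabla X Z)
}.

Definition curvature (nabla : vfield M -> vfield M -> vfield M) X Y Z : vfield M :=
  nabla X (nabla Y Z) - nabla Y (nabla X Z) - nabla (lie_bracket X Y) Z.

Definition ext_deriv (eta : vfield M -> Cinfty M) X Y : Cinfty M :=
  (2^-1 : R) *: (X (eta Y) - Y (eta X) - eta (lie_bracket X Y)).

Definition lie_deriv_endo Z (phi : vfield M -> vfield M) X : vfield M :=
  lie_bracket Z (phi X) - phi (lie_bracket Z X).

Definition nijenhuis (phi : vfield M -> vfield M) X Y : vfield M :=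
  phi (phi (lie_bracket X Y)) + lie_bracket (phi X) (phi Y)
  - phi (lie_bracket (phi X) Y) - phi (lie_bracket X (phi Y)).

(* The [c]-eigenspace of [phi] on the fibre of [ker eta] at [p]. *)
Definition eigendistribution (phi : vfield M -> vfield M)
    (eta : vfield M -> Cinfty M) (c : R) p : set (Cinfty M -> R) :=
  [set v | exists X, [/\ v = vect_at p X, eta X p = 0 &
                         vect_at p (phi X) = c *: v]].

End Tensors.

Definition has_dimension (R : realType) (V : lmodType R) (S : set V) (n : nat) : Prop :=
  exists e : 'I_n -> V,
    (forall a : 'I_n -> R, \sum_i a i *: e i = 0 -> forall i, a i = 0) /\
    S = [set \sum_i a i *: e i | a in [set: 'I_n -> R]].

Section Paracontact.
Variables (R : realType) (n : nat) (M : manifold R (2 * n).+1%N).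
Variables (phi : vfield M -> vfield M) (xi : vfield M) (eta : vfield M -> Cinfty M).
Implicit Types (X Y : vfield M) (p : M).

Record almost_paracontact : Prop := {
  ap_phi_linear : linear phi;
  ap_eta_linear : scalar eta;
  ap_eta_xi : eta xi = 1;
  ap_phi2 : forall X, phi (phi X) = X - eta X *: xi;
  ap_dim_plus : forall p, has_dimension (eigendistribution phi eta 1 p) n;
  ap_dim_minus : forall p, has_dimension (eigendistribution phi eta (-1) p) n
}.

Record paracontact_metric (g : vfield M -> vfield M -> Cinfty M) : Prop := {
  pm_almost_paracontact : almost_paracontact;
  pm_metric : pseudo_riemannian_metric g;
  pm_compatible : forall X Y, g (phi X) (phi Y) = - g X Y + eta X * eta Y;
  pm_deta : forall X Y, ext_deriv eta X Y = g X (phi Y)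
}.

Definition h_tensor X : vfield M := Cinfty_cst M 2^-1 *: lie_deriv_endo xi phi X.

(* The Levi-Civita connection of [g], being unique, enters as the argument
   [nabla]. *)
Record paracontact_kappa_mu (g : vfield M -> vfield M -> Cinfty M)
    (nabla : vfield M -> vfield M -> vfield M) (kappa mu : R) : Prop := {
  km_paracontact_metric : paracontact_metric g;
  km_levi_civita : levi_civita g nabla;
  km_curvature : forall X Y, curvature nabla X Y xi =
    Cinfty_cst M kappa *: (eta Y *: X - eta X *: Y)
    + Cinfty_cst M mu *: (eta Y *: h_tensor X - eta X *: h_tensor Y)
}.

Definition N_phi X Y : vfield M :=
  nijenhuis phi X Y - (2 * ext_deriv eta X Y) *: xi.

Definition integrable_paracontact : Prop :=
  forall X Y, eta X = 0 -> eta Y = 0 ->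
    exists f : Cinfty M, N_phi X Y = f *: xi.

End Paracontact.

(* Main.v *)
From HB Require Import structures.
Require Import Defs.
From mathcomp Require Import all_boot all_order all_algebra.
From mathcomp Require Import boolp reals topology.
From mathcomp Require Import ring.

(** Write T_X := nabla_X phi and D := ker eta.  The bracket is torsion-free, so
    the Nijenhuis tensor is
      T_(phi X) Y - T_(phi Y) X - phi (T_X Y) + phi (T_Y X)
    ([nijenhuis_dphi]), and integrability follows once g(T_X Y, Z) = 0 for X,
    Y, Z in D.  The nullity condition forces this vanishing as soon as h is
    invertible on D.

    On any paracontact metric manifold nabla_X xi = phi h X - phi X
    ([nabla_xi]), with h symmetric and anticommuting with phi.  Hence
    R_(YZ) xi is the skew part of nabla (phi h) minus that of nabla phi
    ([curvature_xi]).  The (kappa, mu) condition is used twice.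
    - For R_(X xi) xi, comparing its values at X and at phi X isolates the part
      of the Jacobi operator commuting with phi and gives h^2 = 1 + kappa on D
      ([h_square]).
    - For Y, Z in D it says R_(YZ) xi = 0.  Together with the closedness of the
      fundamental 2-form ([dphi_cyclic]) this expresses g(T_X Y, Z) through
      derivatives of phi h ([dphi_phi_h]).
    Conjugating two of the three arguments by phi leaves g(T_X Y, Z) unchanged
    on D ([dphi_phi], [dphi_phi_phi]).  In the signed sum of the four resulting
    copies of [dphi_phi_h] the left sides cancel, while the derivatives of
    phi h recombine, because phi h anticommutes with phi, into values of T; what
    remains is g(T_(h X) Y, Z) = 0 ([dphi_h_eq0]).  Replacing X by h X
    multiplies g(T_X Y, Z) by 1 + kappa, which is nonzero.

    Identities between vector fields are checked by pairing both sides with an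
    arbitrary field and comparing functions; nondegeneracy of g
    ([metric_inj]) brings them back. *)

Set Implicit Arguments.
Unset Strict Implicit.
Unset Printing Implicit Defensive.

Import GRing.Theory Num.Theory.
Local Open Scope ring_scope.

(** * Linear combinations of identities *)

(** With [c = d] a combination of known identities, the side condition is a ring
    identity: this is how a goal is closed by a linear combination of
    hypotheses, [eq_addr2] adding them up and [esym] changing a sign. *)
Lemma eq_of_sub (V : zmodType) (a b c d : V) : c = d -> a - b = c - d -> a = b.
Proof. by move=> -> /eqP; rewrite subrr subr_eq0 => /eqP. Qed.

Lemma eq_addr2 (V : zmodType) (a b c d : V) : a = b -> c = d -> a + c = b + d.
Proof. by move=> -> ->. Qed.

(** * Smooth functions and vector fields *)

Section Scalars.
Variables (R : realType) (m : nat) (M : manifold R m).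
Implicit Types (f : Cinfty M) (X Y Z : vfield M).

Lemma Cinfty_cst_val (a : R) (p : M) : Cinfty_cst M a p = a.
Proof. exact: mulr1. Qed.

Lemma Cinfty_cst_cancel (a : R) f : a != 0 -> Cinfty_cst M a * f = 0 -> f = 0.
Proof.
move=> a0 af0; apply/val_inj/funext => p.
have : (Cinfty_cst M a * f) p = 0 by rewrite af0.
rewrite -[LHS]/(Cinfty_cst M a p * f p) Cinfty_cst_val => /eqP.
by rewrite mulf_eq0 (negbTE a0) => /eqP.
Qed.

Lemma Cinfty_half (f g : Cinfty M) : f = (2^-1 : R) *: g -> f + f = g.
Proof.
move=> ->; rewrite -scalerDl -[RHS]scale1r; congr (_ *: _).
by rewrite -mulr2n -[LHS]mulr_natl mulfV ?pnatr_eq0.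
Qed.

Lemma Cinfty_cst_half : Cinfty_cst M 2^-1 + Cinfty_cst M 2^-1 = 1.
Proof. exact: Cinfty_half. Qed.

Lemma Cinfty_double_eq0 f : f + f = 0 -> f = 0.
Proof.
by move=> f0; rewrite -[f]mul1r -Cinfty_cst_half mulrDl -mulrDr f0 mulr0.
Qed.

Lemma vfield_add X f g : X (f + g) = X f + X g.
Proof.
have /asboolP[lX _] := vfield_valP X.
by have := lX 1 f g; rewrite !scale1r.
Qed.

Lemma vfield_opp X f : X (- f) = - X f.
Proof.
have /asboolP[lX _] := vfield_valP X.
have X0 : X 0 = 0 by apply: (addrI (X 0)); rewrite -vfield_add !addr0.
by apply: (addrI (X f)); rewrite -vfield_add !subrr.
Qed.

Lemma vfield_one X : X 1 = 0.
Proof.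
have /asboolP[_ dX] := vfield_valP X.
by have := dX 1 1; rewrite !mulr1 mul1r => e; apply: (addrI (X 1)); rewrite -e addr0.
Qed.

Lemma lie_jacobi X Y Z :
  lie_bracket (lie_bracket X Y) Z + lie_bracket (lie_bracket Y Z) X
  + lie_bracket (lie_bracket Z X) Y = 0.
Proof.
apply: vfieldP => f.
rewrite -[LHS]/(lie_bracket (lie_bracket X Y) Z f +
  lie_bracket (lie_bracket Y Z) X f + lie_bracket (lie_bracket Z X) Y f).
rewrite /= !vfield_add !vfield_opp -[RHS]/(0 : Cinfty M).
by ring.
Qed.

End Scalars.

Section VectorFieldHalving.
Variables (R : realType) (m : nat) (M : manifold R m).

Lemma vfield_double_eq0 (X : vfield M) : X + X = 0 -> X = 0.
Proof.
by move=> X0; rewrite -[X]scale1r -Cinfty_cst_half scalerDl -scalerDr X0 scaler0.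
Qed.

End VectorFieldHalving.

(** * Metric and connection *)

(** The covariant derivative of the endomorphism field [F].  It is locked because
    its body is a difference, on which the additivity rules of the metric would
    otherwise fire. *)
HB.lock Definition cov_endo (R : realType) (m : nat) (M : manifold R m)
    (nabla : vfield M -> vfield M -> vfield M) (F : vfield M -> vfield M)
    (X Y : vfield M) : vfield M :=
  nabla X (F Y) - F (nabla X Y).
Canonical cov_endo_unlockable := Unlockable cov_endo.unlock.

Section Riemannian.
Variables (R : realType) (m : nat) (M : manifold R m).
Variables (g : vfield M -> vfield M -> Cinfty M)
  (nabla : vfield M -> vfield M -> vfield M).
Hypotheses (gP : pseudo_riemannian_metric g) (lc : levi_civita g nabla).
Implicit Types (f : Cinfty M) (U V W X Y Z : vfield M).

Lemma metricC X Y : g X Y = g Y X.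
Proof. by case: gP. Qed.

Lemma metricDr X Y Z : g X (Y + Z) = g X Y + g X Z.
Proof. by case: gP => l _ _; have := l X 1 Y Z; rewrite scale1r mul1r. Qed.

Lemma metric0r X : g X 0 = 0.
Proof. by apply: (addrI (g X 0)); rewrite -metricDr !addr0. Qed.

Lemma metricZr X f Y : g X (f *: Y) = f * g X Y.
Proof. by case: gP => l _ _; have := l X f Y 0; rewrite !addr0 metric0r addr0. Qed.

Lemma metricNr X Y : g X (- Y) = - g X Y.
Proof. by apply: (addrI (g X Y)); rewrite -metricDr !subrr metric0r. Qed.

Lemma metricDl X Y Z : g (Y + Z) X = g Y X + g Z X.
Proof. by rewrite !(metricC _ X) metricDr. Qed.

Lemma metric0l X : g 0 X = 0.
Proof. by rewrite metricC metric0r. Qed.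

Lemma metricZl X f Y : g (f *: Y) X = f * g Y X.
Proof. by rewrite !(metricC _ X) metricZr. Qed.

Lemma metricNl X Y : g (- Y) X = - g Y X.
Proof. by rewrite !(metricC _ X) metricNr. Qed.

(** The rules for scaling are kept apart: a tensor such as [h_tensor], whose body
    is a scaled field, would be unfolded by them. *)
Definition metricE := (metricDl, metricDr, metricNl, metricNr, metric0l,
  metric0r).

Lemma metric_inj X Y : (forall Z, g X Z = g Y Z) -> X = Y.
Proof.
case: gP => _ _ nd XY; apply/eqP; rewrite -subr_eq0; apply/eqP/vfieldP => f.
apply/val_inj/funext => p.
have XY0 Z : g (X - Y) Z p = 0 by rewrite !metricE XY subrr.
exact: (congr1 (fun v => v f) (nd p (X - Y) XY0)).
Qed.

Let cP := lc_connection lc.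

Lemma connDr X Y Z : nabla X (Y + Z) = nabla X Y + nabla X Z.
Proof. exact: (conn_add cP). Qed.

Lemma conn0r X : nabla X 0 = 0.
Proof. by apply: (addrI (nabla X 0)); rewrite -connDr !addr0. Qed.

Lemma connNr X Y : nabla X (- Y) = - nabla X Y.
Proof. by apply: (addrI (nabla X Y)); rewrite -connDr !subrr conn0r. Qed.

Lemma connDl X Y Z : nabla (X + Y) Z = nabla X Z + nabla Y Z.
Proof. by have := conn_linear cP Z 1 X Y; rewrite !scale1r. Qed.

Lemma conn0l X : nabla 0 X = 0.
Proof. by apply: (addrI (nabla 0 X)); rewrite -connDl !addr0. Qed.

Lemma connZl f X Y : nabla (f *: X) Y = f *: nabla X Y.
Proof. by have := conn_linear cP Y f X 0; rewrite !addr0 conn0l addr0. Qed.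

Lemma connNl X Y : nabla (- X) Y = - nabla X Y.
Proof. by apply: (addrI (nabla X Y)); rewrite -connDl !subrr conn0l. Qed.

Definition connE := (connDl, connDr, connNl, connNr, conn0l, conn0r).

Lemma lie_bracket_conn X Y : lie_bracket X Y = nabla X Y - nabla Y X.
Proof. by rewrite (lc_torsion_free lc). Qed.

(** Differentiating g(F Y, Z) = g(Y, G Z) along X: covariant differentiation
    commutes with taking adjoints because the metric is parallel. *)
Lemma cov_endo_adjoint (F G : vfield M -> vfield M) X Y Z :
  (forall U V, g (F U) V = g U (G V)) ->
  g (cov_endo nabla F X Y) Z = g Y (cov_endo nabla G X Z).
Proof.
move=> FG.
have e : X (g (F Y) Z) = X (g Y (G Z)) by rewrite FG.
move: e; rewrite !(lc_metric lc) unlock !metricE -!FG => e.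
by apply: (eq_of_sub e); rewrite !FG; ring.
Qed.

End Riemannian.

(** * The structure tensors of a paracontact metric manifold *)

Section ParacontactMetric.
Variables (R : realType) (n : nat) (M : manifold R (2 * n).+1%N).
Variables (phi : vfield M -> vfield M) (xi : vfield M) (eta : vfield M -> Cinfty M).
Variables (g : vfield M -> vfield M -> Cinfty M)
  (nabla : vfield M -> vfield M -> vfield M).
Hypotheses (pm : paracontact_metric phi xi eta g) (lc : levi_civita g nabla).
Implicit Types (f : Cinfty M) (U V W X Y Z : vfield M).

Let ap : almost_paracontact phi xi eta := pm_almost_paracontact pm.
Let gP : pseudo_riemannian_metric g := pm_metric pm.
Local Notation gE := (metricE gP).
Local Notation nablaE := (connE lc).
Local Notation gC := (metricC gP).

Lemma phiD X Y : phi (X + Y) = phi X + phi Y.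
Proof. by have := ap_phi_linear ap 1 X Y; rewrite !scale1r. Qed.

Lemma phi0 : phi 0 = 0.
Proof. by apply: (addrI (phi 0)); rewrite -phiD !addr0. Qed.

Lemma phiZ f X : phi (f *: X) = f *: phi X.
Proof. by have := ap_phi_linear ap f X 0; rewrite !addr0 phi0 addr0. Qed.

Lemma phiN X : phi (- X) = - phi X.
Proof. by apply: (addrI (phi X)); rewrite -phiD !subrr phi0. Qed.

Definition phiE := (phiD, phiN, phi0).

Let phi2 X : phi (phi X) = X - eta X *: xi := ap_phi2 ap X.
Let eta_xi : eta xi = 1 := ap_eta_xi ap.

Lemma deta_double X Y :
  g X (phi Y) + g X (phi Y) = X (eta Y) - Y (eta X) - eta (lie_bracket X Y).
Proof. by apply: Cinfty_half; rewrite -(pm_deta pm). Qed.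

Lemma etaN X : eta (- X) = - eta X.
Proof.
have eD Y Z : eta (Y + Z) = eta Y + eta Z.
  by have := ap_eta_linear ap 1 Y Z; rewrite scale1r mul1r.
have e0 : eta 0 = 0 by apply: (addrI (eta 0)); rewrite -eD !addr0.
by apply: (addrI (eta X)); rewrite -eD !subrr.
Qed.

(** Inherited from the skewness of d eta. *)
Lemma phi_skew X Y : g (phi X) Y = - g X (phi Y).
Proof.
have LN : lie_bracket Y X = - lie_bracket X Y.
  by rewrite !(lie_bracket_conn lc) opprB.
have e1 := deta_double X Y; have := deta_double Y X; rewrite LN etaN => e2.
apply/eqP; rewrite -subr_eq0 opprK gC; apply/eqP/Cinfty_double_eq0.
by apply: (eq_of_sub (eq_addr2 e1 e2)); ring.
Qed.

(** From phi^3 xi = 0 computed in two ways, phi xi is the multiple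
    g(phi xi, xi) xi, whose coefficient vanishes because phi is skew. *)
Lemma phi_xi : phi xi = 0.
Proof.
have phi2_xi : phi (phi xi) = 0 by rewrite phi2 eta_xi scale1r subrr.
have phi_xiE : phi xi = eta (phi xi) *: xi.
  have := phi2 (phi xi); rewrite phi2_xi phi0.
  by move/eqP; rewrite eq_sym subr_eq0 => /eqP.
have eta_phi_xi : eta (phi xi) = g (phi xi) xi.
  have := pm_compatible pm (phi xi) xi; rewrite eta_xi mulr1 phi2_xi gE.
  by move/eqP; rewrite eq_sym addrC subr_eq0 => /eqP.
rewrite phi_xiE eta_phi_xi; suff -> : g (phi xi) xi = 0 by rewrite scale0r.
by apply: Cinfty_double_eq0; rewrite {1}phi_skew (gC xi) addNr.
Qed.

Lemma eta_metric X : eta X = g xi X.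
Proof.
have := pm_compatible pm xi X; rewrite phi_xi eta_xi mul1r gE.
by move/eqP; rewrite eq_sym addrC subr_eq0 => /eqP.
Qed.

Lemma eta_phi X : eta (phi X) = 0.
Proof. by rewrite eta_metric gC phi_skew phi_xi !gE oppr0. Qed.

Lemma phi3 X : phi (phi (phi X)) = phi X.
Proof. by rewrite phi2 eta_phi scale0r subr0. Qed.

Lemma nabla_xi_perp X : eta (nabla X xi) = 0.
Proof.
have := lc_metric lc X xi xi; rewrite -!eta_metric eta_xi vfield_one.
by rewrite gC -eta_metric => e; apply: Cinfty_double_eq0.
Qed.

(** The definition of d eta, written with the metric dual xi of eta: -2 phi is
    the difference between nabla xi and its adjoint. *)
Lemma nabla_xi_skew X Y :
  g (nabla X xi) Y - g X (nabla Y xi) = - (g (phi X) Y + g (phi X) Y).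
Proof.
have := deta_double X Y; rewrite !eta_metric !(lc_metric lc).
rewrite (lie_bracket_conn lc) !gE => e.
rewrite phi_skew (gC X (nabla Y xi)).
by apply: (eq_of_sub (esym e)); ring.
Qed.

Lemma nabla_xi_xi : nabla xi xi = 0.
Proof.
apply: (metric_inj gP) => Y; have := nabla_xi_skew xi Y.
by rewrite phi_xi -eta_metric nabla_xi_perp !gE subr0 addr0 oppr0.
Qed.

Local Notation dphi := (cov_endo nabla phi).

Lemma dphi_skew X Y Z : g (dphi X Y) Z = - g (dphi X Z) Y.
Proof.
rewrite (@cov_endo_adjoint _ _ _ _ _ gP lc phi (fun V => - phi V)).
  by rewrite unlock nablaE !gE !(gC Y); ring.
by move=> U V; rewrite phi_skew gE.
Qed.

(** Closedness of the fundamental 2-form g(_, phi _) = d eta, a consequence of the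
    Jacobi identity, expressed with a torsion-free connection. *)
Lemma dphi_cyclic X Y Z :
  g (dphi X Y) Z + g (dphi Y Z) X + g (dphi Z X) Y = 0.
Proof.
(* [cov] and [brk] are the two kinds of terms of the exterior derivative of
   2 d eta: derivatives of its values, and its values at brackets. *)
have cov U V W : g (nabla U V) (phi W) + g V (nabla U (phi W)) +
    (g (nabla U V) (phi W) + g V (nabla U (phi W))) =
    U (V (eta W)) - U (W (eta V)) - U (eta (lie_bracket V W)).
  by rewrite -(lc_metric lc) -vfield_add deta_double !vfield_add !vfield_opp.
have brk U V W : g (nabla U V) (phi W) - g (nabla V U) (phi W) +
    (g (nabla U V) (phi W) - g (nabla V U) (phi W)) =
    U (V (eta W)) - V (U (eta W)) - W (eta (lie_bracket U V))
    - eta (lie_bracket (lie_bracket U V) W).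
  have := deta_double (lie_bracket U V) W.
  by rewrite {1 2}(lie_bracket_conn lc) !gE => ->.
have jac : eta (lie_bracket (lie_bracket X Y) Z) +
    eta (lie_bracket (lie_bracket Y Z) X) +
    eta (lie_bracket (lie_bracket Z X) Y) = 0.
  by rewrite !eta_metric -!(metricDr gP) lie_jacobi gE.
rewrite (dphi_skew X) (dphi_skew Y) (dphi_skew Z).
rewrite unlock !gE !phi_skew.
rewrite (gC (nabla X (phi Z))) (gC (nabla Y (phi X))) (gC (nabla Z (phi Y))).
apply: Cinfty_double_eq0.
apply: (eq_of_sub (eq_addr2 (eq_addr2 (eq_addr2 (brk X Y Z)
  (eq_addr2 (brk Y Z X) (brk Z X Y))) (esym (eq_addr2 (cov X Y Z)
  (eq_addr2 (cov Y Z X) (cov Z X Y))))) (esym jac))).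
by ring.
Qed.

Lemma dphi_xi X : dphi X xi = - phi (nabla X xi).
Proof. by rewrite unlock phi_xi nablaE add0r. Qed.

Lemma phi2_ker X : eta X = 0 -> phi (phi X) = X.
Proof. by move=> eX; rewrite phi2 eX scale0r subr0. Qed.

(** The cyclic identity at xi involves only nabla xi, since the other two terms
    differentiate phi xi = 0. *)
Lemma dphi_xi_formula Y : dphi xi Y =
  - phi (nabla Y xi) - nabla (phi Y) xi - (phi (phi Y) + phi (phi Y)).
Proof.
apply: (metric_inj gP) => Z.
have := dphi_cyclic xi Y Z; rewrite (dphi_skew Y) !dphi_xi.
have := nabla_xi_skew Z (phi Y).
rewrite !gE !phi_skew (gC Z (phi (phi Y))) !phi_skew (gC Z (nabla _ _)).
by move=> e1 e2; apply: (eq_of_sub (eq_addr2 (esym e1) e2)); ring.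
Qed.

Lemma nabla_phi2_xi Y : nabla (phi (phi Y)) xi = nabla Y xi.
Proof. by rewrite phi2 !nablaE (connZl lc) nabla_xi_xi scaler0 oppr0 addr0. Qed.

(** The formula above makes nabla_xi phi commute with phi, whereas differentiating
    phi^2 = 1 - eta (x) xi along the geodesic field xi makes it anticommute. *)
Lemma dphi_along_xi Y : dphi xi Y = 0.
Proof.
have comm : dphi xi (phi Y) = phi (dphi xi Y).
  rewrite !dphi_xi_formula !phiE nabla_phi2_xi (phi2_ker (nabla_xi_perp Y)).
  by rewrite [- _ - nabla Y xi]addrC.
have anti : dphi xi (phi Y) = - phi (dphi xi Y).
  have xi_eta : xi (eta Y) = eta (nabla xi Y).
    by rewrite !eta_metric (lc_metric lc) nabla_xi_xi !gE add0r.
  rewrite unlock !phiE !phi2 !nablaE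
    (conn_leibniz (lc_connection lc)) nabla_xi_xi scaler0 addr0 xi_eta.
  by rewrite opprB addrC.
have phi_dphi : phi (dphi xi Y) = 0.
  by apply: vfield_double_eq0; rewrite -{1}comm anti addNr.
have := phi2 (dphi xi Y); rewrite phi_dphi phi0.
rewrite eta_metric gC dphi_skew dphi_xi nabla_xi_xi phi0 !gE !oppr0.
by rewrite scale0r subr0 => <-.
Qed.

Lemma nabla_xi_phi Y : nabla xi (phi Y) = phi (nabla xi Y).
Proof.
apply/eqP; rewrite -subr_eq0; apply/eqP.
by rewrite -(dphi_along_xi Y) unlock.
Qed.

(* Locked so that unification treats h as an atom instead of unfolding it. *)
Local Notation h := (locked (h_tensor phi xi)).

Lemma nabla_phi_xi X :
  nabla (phi X) xi = - phi (nabla X xi) - (phi (phi X) + phi (phi X)).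
Proof.
apply: (metric_inj gP) => Z.
have := congr1 (g^~ Z) (dphi_xi_formula X); rewrite dphi_along_xi !gE => e.
by apply: (eq_of_sub e); ring.
Qed.

(** The Lie derivative of phi along xi is nabla_xi phi = 0 plus the commutator of
    phi with nabla xi, and the anticommutator of the two is -2 phi^2. *)
Lemma h_nabla X : h X = phi (nabla X xi) + phi (phi X).
Proof.
apply/eqP; rewrite -subr_eq0; apply/eqP/vfield_double_eq0.
have h_double : h X + h X = lie_deriv_endo xi phi X.
  by rewrite -lock -scalerDl Cinfty_cst_half scale1r.
rewrite addrACA h_double /lie_deriv_endo !(lie_bracket_conn lc) !phiE.
rewrite nabla_phi_xi nabla_xi_phi.
by apply: (metric_inj gP) => Z; rewrite !gE; ring.
Qed.

Lemma nabla_xi X : nabla X xi = phi (h X) - phi X.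
Proof.
by rewrite h_nabla phiD phi3 addrK (phi2_ker (nabla_xi_perp X)).
Qed.

Lemma hD X Y : h (X + Y) = h X + h Y.
Proof. by rewrite !h_nabla !nablaE !phiE addrACA. Qed.

Lemma hN X : h (- X) = - h X.
Proof. by rewrite !h_nabla !nablaE !phiE opprD. Qed.

Lemma h_xi : h xi = 0.
Proof. by rewrite h_nabla nabla_xi_xi phi_xi !phi0 addr0. Qed.

Lemma h_phi X : h (phi X) = - phi (h X).
Proof.
rewrite !h_nabla nabla_phi_xi !phiE !phi3.
by apply: (metric_inj gP) => Z; rewrite !gE; ring.
Qed.

Lemma h_symmetric X Y : g (h X) Y = g X (h Y).
Proof.
have := nabla_xi_skew X (phi Y); rewrite nabla_phi_xi !h_nabla.
rewrite !gE !phi_skew => e.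
by apply: (eq_of_sub (esym e)); ring.
Qed.

Lemma eta_h X : eta (h X) = 0.
Proof. by rewrite eta_metric -h_symmetric h_xi gE. Qed.

Local Notation psi := (fun X => phi (h X)).

Lemma phi_h_symmetric X Y : g (phi (h X)) Y = g X (phi (h Y)).
Proof. by rewrite phi_skew h_symmetric h_phi gE opprK. Qed.

(** * Curvature in the direction of xi *)

Lemma curvature_xi X Y : curvature nabla X Y xi =
  (cov_endo nabla psi X Y - cov_endo nabla psi Y X) - (dphi X Y - dphi Y X).
Proof.
rewrite /curvature (lie_bracket_conn lc) !nabla_xi !nablaE hD hN !phiE unlock /=.
by apply: (metric_inj gP) => Z; rewrite !gE; ring.
Qed.

Lemma curvature_xi_xi X : curvature nabla X xi xi =
  h (h X) - phi (phi X) - phi (nabla xi (h X) - h (nabla xi X)).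
Proof.
rewrite curvature_xi dphi_along_xi dphi_xi unlock /= h_xi phi0 !nablaE.
rewrite nabla_xi_phi !nabla_xi !hD !hN !h_phi !phiE.
rewrite (phi2_ker (eta_h (h X))) (phi2_ker (eta_h X)).
by apply: (metric_inj gP) => Z; rewrite !gE; ring.
Qed.

(** * Symmetries of the derivative of phi on ker eta *)

(** On ker eta, phi^2 = 1 is parallel up to multiples of xi, so nabla_X phi
    anticommutes with the skew endomorphism phi. *)
Lemma dphi_phi X Y Z : eta Y = 0 -> eta Z = 0 ->
  g (dphi X (phi Y)) Z = g (dphi X Y) (phi Z).
Proof.
by move=> eY eZ; rewrite unlock (phi2_ker eY) !gE !phi_skew (phi2_ker eZ); ring.
Qed.

(** Write t(X, Y, Z) = g((nabla_X phi) Y, Z) and s(X, Y, Z) = t(phi X, phi Y, Z).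
    Closedness at (phi X, phi Y, Z) reads s(X, Y, Z) + s(Y, Z, X) + t(Z, X, Y) =
    0; its three rotations, together with the cyclic sum of t being zero, form a
    linear system that gives s = t. *)
Lemma dphi_phi_phi X Y Z : eta X = 0 -> eta Y = 0 -> eta Z = 0 ->
  g (dphi (phi X) (phi Y)) Z = g (dphi X Y) Z.
Proof.
move=> eX eY eZ; pose s U V W := g (dphi (phi U) (phi V)) W.
have s_cyclic U V W : eta U = 0 -> eta V = 0 -> eta W = 0 ->
    s U V W + s V W U + g (dphi W U) V = 0.
  move=> eU eV eW; rewrite -(dphi_cyclic (phi U) (phi V) W) /s.
  rewrite -!(dphi_phi (phi V) eW eU) //.
  by rewrite (dphi_phi W) ?eta_phi // (phi2_ker eV).
(* e1 - e2 + e3 is 2 s(X, Y, Z) plus t(Z, X, Y) - t(X, Y, Z) + t(Y, Z, X). *)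
have e1 := s_cyclic X Y Z eX eY eZ.
have e2 := s_cyclic Y Z X eY eZ eX.
have e3 := s_cyclic Z X Y eZ eX eY.
have e0 := dphi_cyclic X Y Z.
apply/eqP; rewrite -subr_eq0; apply/eqP/Cinfty_double_eq0.
rewrite -/(s X Y Z).
apply: (eq_of_sub (eq_addr2 (eq_addr2 e1 e3) (esym (eq_addr2 e2 e0)))).
by ring.
Qed.

(** * The nullity condition *)

Section Nullity.
Variables (kappa mu : R).
Hypothesis nullity : forall X Y, curvature nabla X Y xi =
    Cinfty_cst M kappa *: (eta Y *: X - eta X *: Y)
    + Cinfty_cst M mu *: (eta Y *: h X - eta X *: h Y).

(** The Jacobi operator X |-> R_(X xi) xi equals h^2 - phi^2 plus the term
    - phi (nabla_xi h), which anticommutes with phi as mu h does; the parts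
    commuting with phi must therefore agree, which gives h^2 - 1 = kappa. *)
Lemma h_square X : eta X = 0 -> h (h X) = X + Cinfty_cst M kappa *: X.
Proof.
move: (Cinfty_cst M kappa) (Cinfty_cst M mu) nullity => k m curv eX.
have jacobi_op Y : eta Y = 0 ->
    h (h Y) - Y - phi (nabla xi (h Y) - h (nabla xi Y)) = k *: Y + m *: h Y.
  move=> eY; rewrite -{2}(phi2_ker eY) -curvature_xi_xi curv eta_xi eY.
  by rewrite !scale1r !scale0r !subr0.
pose W := phi (phi (nabla xi (h X) - h (nabla xi X))).
(* [e1] is phi applied to the identity at X and [e2] is the identity at phi X;
   adding them kills the anticommuting parts. *)
have e1 : phi (h (h X)) - phi X - W = k *: phi X + m *: phi (h X).
  by rewrite -(phiZ k) -(phiZ m) -[RHS]phiD -jacobi_op // /W !phiE.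
have e2 : phi (h (h X)) - phi X + W = k *: phi X - m *: phi (h X).
  rewrite -scalerN -h_phi -jacobi_op ?eta_phi // nabla_xi_phi !h_phi.
  by rewrite nablaE nabla_xi_phi hN h_phi /W !phiE !opprK opprD opprK.
rewrite -(phi2_ker (eta_h (h X))) -{2 3}(phi2_ker eX) -(phiZ k) -phiD; congr phi.
move: e1 e2.
move: W (phi (h (h X))) (phi (h X)) (phi X) => W U V Y e1 e2.
apply/eqP; rewrite -subr_eq0; apply/eqP/vfield_double_eq0.
apply: (metric_inj gP) => Z.
have := congr1 (g^~ Z) (eq_addr2 e1 e2); rewrite !gE !(metricZl gP) => e.
by apply: (eq_of_sub e); ring.
Qed.

Lemma cov_phi_h_symmetric X Y Z :
  g (cov_endo nabla psi X Y) Z = g (cov_endo nabla psi X Z) Y.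
Proof. by rewrite (cov_endo_adjoint gP lc _ _ _ phi_h_symmetric) gC. Qed.

(** For Y, Z in ker eta the nullity condition says R_(YZ) xi = 0, so nabla phi and
    nabla (phi h) have the same skew part there; closedness turns the skew part
    of nabla phi into a single term. *)
Lemma dphi_phi_h X Y Z : eta Y = 0 -> eta Z = 0 -> g (dphi X Y) Z =
  g (cov_endo nabla psi Z X) Y - g (cov_endo nabla psi Y X) Z.
Proof.
move=> eY eZ.
have e : g (cov_endo nabla psi Y Z) X - g (cov_endo nabla psi Z Y) X =
    g (dphi Y Z) X - g (dphi Z Y) X.
  rewrite -!(metricNl gP) -!(metricDl gP); congr (g _ X); apply/eqP.
  by rewrite -subr_eq0 -curvature_xi nullity eY eZ !scale0r subrr !scaler0 addr0.
rewrite !(cov_phi_h_symmetric _ X).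
have := dphi_cyclic X Y Z; rewrite (dphi_skew Z) => e'.
apply: (eq_of_sub (eq_addr2 e' e)).
by ring.
Qed.

(** Differentiating the anticommutation of phi h with phi: its failure for the
    derivative of phi h is expressed by the derivative of phi. *)
Lemma cov_phi_h_phi X Y Z :
  g (cov_endo nabla psi X (phi Y)) Z - g (cov_endo nabla psi X Y) (phi Z) =
  - g (dphi X Y) (phi (h Z)) - g (dphi X (phi (h Y))) Z.
Proof.
rewrite unlock /= !h_phi !phiE !nablaE !gE.
rewrite -!phi_h_symmetric !h_phi !phiE !gE !phi_skew.
by ring.
Qed.

(** The derivatives of phi h in the directions Z and phi Z that occur in the
    four-term sum of [dphi_h_eq0].  Each of the two differences on the left
    contributes - g((nabla_Z phi) (h X), Y), and their terms with h Y cancel. *)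
Lemma cov_phi_h_defect X Y Z : eta X = 0 -> eta Y = 0 -> eta Z = 0 ->
  g (cov_endo nabla psi Z (phi X)) (phi Y) - g (cov_endo nabla psi Z X) Y
  + (g (cov_endo nabla psi (phi Z) (phi X)) Y
     - g (cov_endo nabla psi (phi Z) X) (phi Y))
  = - (g (dphi Z (h X)) Y + g (dphi Z (h X)) Y).
Proof.
move=> eX eY eZ.
rewrite -{2}(phi2_ker eY) !cov_phi_h_phi.
rewrite !h_phi phiN (phi2_ker (eta_h Y)).
rewrite dphi_phi ?eta_h ?eta_phi // (phi2_ker eY).
rewrite dphi_phi_phi ?eta_h //.
rewrite (dphi_skew (phi Z)) dphi_phi_phi ?eta_h // (dphi_skew Z (h Y)).
rewrite gE.
by ring.
Qed.

Lemma dphi_h_eq0 X Y Z : eta X = 0 -> eta Y = 0 -> eta Z = 0 ->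
  g (dphi (h X) Y) Z = 0.
Proof.
move=> eX eY eZ.
have d1 := cov_phi_h_defect eX eY eZ.
have d2 := cov_phi_h_defect eX eZ eY; rewrite (dphi_skew Y (h X)) in d2.
have f1 := dphi_phi_h X eY eZ.
have f2 := dphi_phi_h X (eta_phi Y) (eta_phi Z).
rewrite (dphi_phi X eY (eta_phi Z)) (phi2_ker eZ) in f2.
have f3 := dphi_phi_h (phi X) (eta_phi Y) eZ.
rewrite dphi_phi_phi // in f3.
have f4 := dphi_phi_h (phi X) eY (eta_phi Z).
rewrite -dphi_phi // dphi_phi_phi // in f4.
have cyc := dphi_cyclic (h X) Y Z.
apply: Cinfty_double_eq0.
(* f1 + f2 - f3 - f4 cancels on the left, and on its right the derivatives of
   phi h group into the two defects d1 and d2. *)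
apply: (eq_of_sub (eq_addr2 (eq_addr2 cyc cyc) (eq_addr2
  (eq_addr2 (esym d1) d2)
  (eq_addr2 (eq_addr2 f1 f2) (esym (eq_addr2 f3 f4)))))).
by ring.
Qed.

(** Since h^2 = 1 + kappa on ker eta, every X there is a multiple of h (h X). *)
Lemma dphi_eq0 X Y Z : kappa <> -1 -> eta X = 0 -> eta Y = 0 -> eta Z = 0 ->
  g (dphi X Y) Z = 0.
Proof.
move=> k1 eX eY eZ.
have := dphi_h_eq0 (eta_h X) eY eZ.
rewrite (h_square eX).
have -> : dphi (X + Cinfty_cst M kappa *: X) Y =
    dphi X Y + Cinfty_cst M kappa *: dphi X Y.
  rewrite unlock !nablaE !(connZl lc) phiD phiZ scalerBr.
  by rewrite opprD addrACA.
rewrite (metricDl gP) (metricZl gP) -{1}[g (dphi X Y) Z]mul1r -mulrDl.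
have -> : 1 + Cinfty_cst M kappa = Cinfty_cst M (1 + kappa).
  by rewrite /Cinfty_cst scalerDl scale1r.
apply: Cinfty_cst_cancel; apply/eqP => k0; apply: k1.
by apply/eqP; rewrite -addr_eq0 addrC k0.
Qed.

(** * The Nijenhuis tensor *)

Lemma nijenhuis_dphi X Y : nijenhuis phi X Y =
  dphi (phi X) Y - dphi (phi Y) X - phi (dphi X Y) + phi (dphi Y X).
Proof.
rewrite /nijenhuis !(lie_bracket_conn lc) unlock !phiE.
by apply: (metric_inj gP) => Z; rewrite !gE; ring.
Qed.

Lemma nijenhuis_parallel_xi X Y : kappa <> -1 -> eta X = 0 -> eta Y = 0 ->
  nijenhuis phi X Y = eta (nijenhuis phi X Y) *: xi.
Proof.
move=> k1 eX eY.
have N_ker Z : eta Z = 0 -> g (nijenhuis phi X Y) Z = 0.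
  move=> eZ; rewrite nijenhuis_dphi !gE !phi_skew.
  by rewrite !dphi_eq0 ?eta_phi // !oppr0 !addr0.
apply/eqP; rewrite -subr_eq0 -phi2; apply/eqP/(metric_inj gP) => Z.
by rewrite !phi_skew opprK N_ker ?eta_phi // !gE.
Qed.

End Nullity.

End ParacontactMetric.

Theorem corollary3p3 (R : realType) (n : nat) (M : manifold R (2 * n).+1)
    (phi : vfield M -> vfield M) (xi : vfield M) (eta : vfield M -> Cinfty M)
    (g : vfield M -> vfield M -> Cinfty M)
    (nabla : vfield M -> vfield M -> vfield M) (kappa mu : R) :
  paracontact_kappa_mu phi xi eta g nabla kappa mu ->
  kappa <> (-1)%R ->
  integrable_paracontact phi xi eta.
Proof.
case=> pm lc curv k1 X Y eX eY.
exists (eta (nijenhuis phi X Y) - 2 * ext_deriv eta X Y).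
rewrite /N_phi {1}(@nijenhuis_parallel_xi _ _ _ _ _ _ _ _ pm lc kappa mu) //.
  by rewrite scalerBl.
by rewrite -lock.
Qed.
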